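(* Let $X\subseteq\{0,1\}^n$ be an intersecting family and $f(x):=\min\{f_1(x),f_2(x)\}$ for $x\in X$, where $f_1,f_2:X\to\mathbb{R}$ are intersecting submodular and either $\mathbf 0\notin X$ or $f_k(\mathbf 0)\ge0$ for $k=1,2$. Let $\bar f_1,\bar f_2:\{0,1\}^n\to\mathbb{R}$ be the extensions of $f_1,f_2$ defined in the context. Then, for a given point $(\bar x,\bar\mu)\in\mathbb{Q}^{n+1}$ with $\bar x\in\operatorname{cone}(X)$, the separation problem for $\operatorname{sconv}(f)$ at $(\bar x,\bar\mu)$ reduces to the weighted polymatroid intersection problem $$\max\{\langle\bar x,\alpha\rangle\mid\alpha\in\mathrm{EP}_{\bar f_1}\cap\mathrm{EP}_{\bar f_2}\}$$ for the submodular functions $\bar f_1$ and $\bar f_2$ with weight vector $\bar x$.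
   Context: $[n]=\{1,\dots,n\}$; $\vee,\wedge$ are componentwise max and min. $X\subseteq\{0,1\}^n$ is an intersecting family if $x\wedge y\ne\mathbf 0$, $x,y\in X$, imply $x\vee y,x\wedge y\in X$; $g:X\to\mathbb{R}$ is intersecting submodular if $g(x)+g(y)\ge g(x\vee y)+g(x\wedge y)$ for all $x,y\in X$ with $x\wedge y\ne\mathbf 0$. For $g:\{0,1\}^n\to\mathbb{R}$, $\mathrm{EP}_g=\{\alpha\in\mathbb{R}^n\mid\langle\alpha,v\rangle\le g(v)\ \forall v\in\{0,1\}^n\}$. A function $p$ on a convex cone is sublinear if $p(rx)=rp(x)$ for $r\ge0$ and $p(x+y)\le p(x)+p(y)$. $\operatorname{sconv}(f)$ is the largest sublinear function on $\operatorname{cone}(X)$ (convex conic hull) that is $\le f$ on $X$. The separation problem for $\operatorname{sconv}(f)$ at $(\bar x,\bar\mu)$ asks to either conclude $\bar\mu\ge\operatorname{sconv}(f)(\bar x)$ or find an affine underestimator of $\operatorname{sconv}(f)$ on $\operatorname{cone}(X)$ whose value at $\bar x$ exceeds $\bar\mu$. ''Reduces to'' means: the optimal value of the maximization problem equals $\operatorname{sconv}(f)(\bar x)$ and an optimal solution $\alpha^*$ yields a linear underestimator $\langle\alpha^*,x\rangle$ of $\operatorname{sconv}(f)$, so solving it answers the separation problem. Dilworth truncation: $\check X:=\{\sum_{v\in V}v\mid V\subseteq X,\ \sum_{v\in V}v\le\mathbf 1\}$ (the empty sum is $\mathbf 0$, so $\mathbf 0\in\check X$), and $\check f_k(x):=\min_{V\subseteq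 X}\{\sum_{v\in V}f_k(v)\mid\sum_{v\in V}v=x\}$ for $x\in\check X$, with $\check f_k(\mathbf 0)=0$. It is known that $\check X$ is a lattice family (closed under $\vee,\wedge$) and $\check f_k$ is submodular on it. Retraction: $\check X$ has a pre-order representation $\check X=\{x\in\{0,1\}^n\mid x_i=0\ (i\in I^0),\ x_i\ge x_j\ ((i,j)\in D)\}$ with $D$ reflexive and transitive and such that $(i,j)\in D$, $i\in I^0$ imply $j\in I^0$. Then $\rho:\{0,1\}^n\to\check X$ is $\rho(x)_i=\max_{j:(i,j)\in D}(x\wedge\top)_j$ with $\top=\sum_{i\notin I^0}e_i$. Extension: $\bar f_k(x):=\check f_k(\rho(x))+C\|x-\rho(x)\|_1$ for $x\in\{0,1\}^n$, where $C=n^2(f^U-f^L)$ and $f^L\le\check f_k(x)\le f^U$ for $x\in\check X$, $k=1,2$. *)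

(* Defs.v *)
(* MathComp world, with classical sets and realType from MathComp-Analysis. *)
From HB Require Import structures.
From mathcomp Require Import all_boot all_order all_algebra.
From mathcomp Require Import boolp classical_sets reals.

Set Implicit Arguments.
Unset Strict Implicit.
Unset Printing Implicit Defensive.

Import Order.TTheory GRing.Theory Num.Theory.

Local Open Scope ring_scope.

(* {0,1}^n *)
Notation cube n := {ffun 'I_n -> bool}.

Definition cube0 {n : nat} : cube n := [ffun=> false].
Definition vjoin {n : nat} (x y : cube n) : cube n := [ffun i => x i || y i].
Definition vmeet {n : nat} (x y : cube n) : cube n := [ffun i => x i && y i].

Definition vec {R : realType} {n : nat} (v : cube n) : 'rV[R]_n :=
  \row_i (v i)%:R.

Definition dot {R : realType} {n : nat} (a x : 'rV[R]_n) : R :=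
  \sum_(i < n) a 0 i * x 0 i.

Definition intersecting_family {n : nat} (X : {set cube n}) : Prop :=
  forall x y, x \in X -> y \in X -> vmeet x y != cube0 ->
    (vjoin x y \in X) && (vmeet x y \in X).

(* A function on X is represented by a total function of which only the
   values on X matter; likewise below for functions on a cone. *)
Definition intersecting_submodular {R : realType} {n : nat}
    (X : {set cube n}) (g : cube n -> R) : Prop :=
  forall x y, x \in X -> y \in X -> vmeet x y != cube0 ->
    g (vjoin x y) + g (vmeet x y) <= g x + g y.

Definition submodular {R : realType} {n : nat} (g : cube n -> R) : Prop :=
  forall x y, g (vjoin x y) + g (vmeet x y) <= g x + g y.

Definition EP {R : realType} {n : nat} (g : cube n -> R) : set 'rV[R]_n :=
  [set a | forall v : cube n, dot a (vec v) <= g v]%classic.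

(* For empty X this is {0}. *)
Definition cone {R : realType} {n : nat} (X : {set cube n}) : set 'rV[R]_n :=
  [set x | exists lam : cube n -> R,
     (forall v, 0 <= lam v) /\ x = \sum_(v in X) lam v *: vec v]%classic.

Definition sublinear_on {R : realType} {n : nat} (K : set 'rV[R]_n)
    (p : 'rV[R]_n -> R) : Prop :=
  (forall (r : R) x, 0 <= r -> K x -> p (r *: x) = r * p x) /\
  (forall x y, K x -> K y -> p (x + y) <= p x + p y).

Definition sublinear_minorant {R : realType} {n : nat} (X : {set cube n})
    (f : cube n -> R) (p : 'rV[R]_n -> R) : Prop :=
  sublinear_on (cone X) p /\ (forall v, v \in X -> p (vec v) <= f v).

Definition is_sconv {R : realType} {n : nat} (X : {set cube n})
    (f : cube n -> R) (p : 'rV[R]_n -> R) : Prop :=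
  sublinear_minorant X f p /\
  (forall q, sublinear_minorant X f q -> forall x, cone X x -> q x <= p x).

(* The values on cone X are determined by is_sconv as soon as a largest
   sublinear minorant exists; values outside cone X are irrelevant. *)
Definition sconv {R : realType} {n : nat} (X : {set cube n})
    (f : cube n -> R) : 'rV[R]_n -> R :=
  xget (fun=> 0) (is_sconv X f : set ('rV[R]_n -> R)).

(* The condition that the sum be at most the all-ones vector is implied,
   since x is a 0/1 vector. *)
Definition sums_to {n : nat} (V : {set cube n}) (x : cube n) : bool :=
  [forall i, (\sum_(v in V) v i)%N == x i].

Definition dilworth_dom {n : nat} (X : {set cube n}) (x : cube n) : bool :=
  [exists V : {set cube n}, (V \subset X) && sums_to V x].

(* The minimum over decompositions is a sum over a minimizing V.  The argument
   X of arg min is only the value returned when no V satisfies the constraint,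
   i.e. when x is not in dilworth_dom X. *)
Definition dilworth {R : realType} {n : nat} (X : {set cube n})
    (g : cube n -> R) (x : cube n) : R :=
  if x == cube0 then 0 else
  let cost (V : {set cube n}) := \sum_(v in V) g v in
  cost [arg min_(V < X | (V \subset X) && sums_to V x) cost V]%O.

Definition preorder_representation {n : nat} (Y : pred (cube n))
    (I0 : {set 'I_n}) (D : rel 'I_n) : Prop :=
  [/\ reflexive D, transitive D,
      forall i j, D i j -> i \in I0 -> j \in I0 &
      forall x : cube n,
        Y x <-> (forall i, i \in I0 -> x i = false) /\
                (forall i j, D i j -> (x j <= x i)%N)].

Definition vtop {n : nat} (I0 : {set 'I_n}) : cube n := [ffun i => i \notin I0].

(* Disjunction is the maximum of 0/1 values. *)
Definition retraction {n : nat} (I0 : {set 'I_n}) (D : rel 'I_n)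
    (x : cube n) : cube n :=
  [ffun i => \big[orb/false]_(j | D i j) vmeet x (vtop I0) j].

Definition dist1 {R : realType} {n : nat} (x y : cube n) : R :=
  \sum_(i < n) `|(x i)%:R - (y i)%:R|.

Definition extension {R : realType} {n : nat} (X : {set cube n})
    (I0 : {set 'I_n}) (D : rel 'I_n) (fL fU : R) (g : cube n -> R)
    (x : cube n) : R :=
  dilworth X g (retraction I0 D x)
  + (n%:R ^+ 2 * (fU - fL)) * dist1 x (retraction I0 D x).

Definition is_maximizer {R : realType} {n : nat} (w : 'rV[R]_n)
    (P : set 'rV[R]_n) (a : 'rV[R]_n) : Prop :=
  P a /\ (forall b, P b -> dot w b <= dot w a).

(* Outputs of the separation problem for p on K at (xbar, mubar): None is the
   conclusion mubar >= p(xbar); Some (a, b) is the affine function <a, x> + b. *)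
Definition separation_answer {R : realType} {n : nat} (K : set 'rV[R]_n)
    (p : 'rV[R]_n -> R) (xbar : 'rV[R]_n) (mubar : R)
    (o : option ('rV[R]_n * R)) : Prop :=
  match o with
  | None => p xbar <= mubar
  | Some (a, b) =>
      (forall x, K x -> dot a x + b <= p x) /\ mubar < dot a xbar + b
  end.

(* Main.v *)
Require Import Defs.
From HB Require Import structures.
From mathcomp Require Import all_boot all_order all_algebra.
From mathcomp Require Import boolp classical_sets reals.
From mathcomp Require Import ring lra.

(** Write h1, h2 for the Dilworth truncations of f1, f2 on their common domain
    Y, C for the penalty constant n^2 (fU - fL), and s for sconv X f, which
    exists because a pointwise supremum of sublinear minorants is again one.

    One inequality is immediate.  On X the extension g_k equals h_k, and
    h_k <= f_k, so a point a of EP g1 and EP g2 defines a linear, hence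
    sublinear, minorant of f: therefore <a, x> <= s x on the whole cone, and the
    maximum is at most s xbar.  It remains to find a feasible a with
    s xbar <= <a, xbar>, for it is then a maximizer, and all maximizers share
    its value.

    If there is no such a, then by [farkas] there are nonnegative weights y1, y2
    on the cube whose combination of vertices is a multiple x of xbar and
    whose cost sum y1 g1 + sum y2 g2 is below s x.  [penalty_exact] excludes
    this.  Replacing each vertex v by its retraction turns the two parts of the
    combination into vectors p and q in the cone of Y, whose sum exceeds x by
    some c >= 0; the cost contains a penalty of at least C G, where G is the sum
    of the entries of c.  With this budget p + q is repaired to x:
    - [monotone_split] finds a such that a and x - a both lie in the cone of Y
      and 0 <= p - a <= G in each coordinate.  Since (x - a) - q = (p - a) - c,
      the two vectors together move by at most (2n - 1) G <= n^2 G in the l1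
      norm ([split_distance]).
    - [minorant_perturb] shows that a move costs at most fU - fL per unit of l1
      norm: the greedy algorithm ([chain_greedy]) gives a linear form below h_k
      on Y that bounds s at the new point, and all of its coefficients, being
      differences of two values of h_k, lie between -(fU - fL) and fU - fL.
    Then s x <= s a + s (x - a) is at most the given cost.

    Submodularity of g_k has two sources.  [dilworth_submodular] uncrosses the
    blocks of two decompositions one at a time.  The retraction preserves joins
    but not meets; where it shrinks a meet, the total distance drops by at least
    1, and C dominates the variation fU - fL of h_k ([extension_submodular]). *)

Set Implicit Arguments.
Unset Strict Implicit.
Unset Printing Implicit Defensive.

Import Order.TTheory GRing.Theory Num.Theory.

Local Open Scope ring_scope.

(** * Cones and sublinear minorants *)

Lemma dotC (R : realType) (n : nat) (a x : 'rV[R]_n) : dot a x = dot x a.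
Proof. by apply: eq_bigr => i _; rewrite mulrC. Qed.

Lemma dotDr (R : realType) (n : nat) (a x y : 'rV[R]_n) :
  dot a (x + y) = dot a x + dot a y.
Proof. by rewrite -big_split; apply: eq_bigr => i _; rewrite mxE mulrDr. Qed.

Lemma dotDl (R : realType) (n : nat) (a b x : 'rV[R]_n) :
  dot (a + b) x = dot a x + dot b x.
Proof. by rewrite dotC dotDr !(dotC x). Qed.

Lemma dotZr (R : realType) (n : nat) (r : R) (a x : 'rV[R]_n) :
  dot a (r *: x) = r * dot a x.
Proof. by rewrite mulr_sumr; apply: eq_bigr => i _; rewrite mxE mulrCA. Qed.

Lemma dot0r (R : realType) (n : nat) (a : 'rV[R]_n) : dot a 0 = 0.
Proof. by apply: big1 => i _; rewrite mxE mulr0. Qed.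

Lemma dot_sumr (R : realType) (n : nat) (I : Type) (r : seq I) (P : pred I)
    (a : 'rV[R]_n) (z : I -> 'rV[R]_n) :
  dot a (\sum_(i <- r | P i) z i) = \sum_(i <- r | P i) dot a (z i).
Proof. exact: (big_morph _ (dotDr a) (dot0r a)). Qed.

Lemma vec_cube0 (R : realType) (n : nat) : vec (@cube0 n) = 0 :> 'rV[R]_n.
Proof. by apply/rowP => i; rewrite !mxE ffunE. Qed.

Lemma coneD (R : realType) (n : nat) (X : {set cube n}) (x y : 'rV[R]_n) :
  cone X x -> cone X y -> cone X (x + y).
Proof.
move=> [lam [lam0 ->]] [mu [mu0 ->]]; exists (fun v => lam v + mu v); split.
  by move=> v; rewrite addr_ge0.
by rewrite -big_split; apply: eq_bigr => v _; rewrite scalerDl.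
Qed.

Lemma coneZ (R : realType) (n : nat) (X : {set cube n}) (r : R) (x : 'rV[R]_n) :
  0 <= r -> cone X x -> cone X (r *: x).
Proof.
move=> r0 [lam [lam0 ->]]; exists (fun v => r * lam v); split.
  by move=> v; rewrite mulr_ge0.
by rewrite scaler_sumr; apply: eq_bigr => v _; rewrite scalerA.
Qed.

Lemma cone0 (R : realType) (n : nat) (X : {set cube n}) : cone X (0 : 'rV[R]_n).
Proof. by exists (fun=> 0); split=> //; rewrite big1 // => v _; rewrite scale0r. Qed.

Lemma cone_vec (R : realType) (n : nat) (X : {set cube n}) (v : cube n) :
  v \in X -> cone X (vec v : 'rV[R]_n).
Proof.
move=> vX; exists (fun w => (w == v)%:R); split=> [w|]; first exact: ler0n.
rewrite (bigD1 v) //= eqxx scale1r big1 ?addr0 // => w /andP[_ /negbTE->].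
by rewrite scale0r.
Qed.

Lemma sublinear_comb (R : realType) (n : nat) (X : {set cube n})
    (s : 'rV[R]_n -> R) (I : finType) (P : pred I) (lam : I -> R)
    (z : I -> 'rV[R]_n) :
  sublinear_on (cone X) s -> (forall i, P i -> 0 <= lam i) ->
  (forall i, P i -> cone X (z i)) ->
  cone X (\sum_(i | P i) lam i *: z i) /\
  s (\sum_(i | P i) lam i *: z i) <= \sum_(i | P i) lam i * s (z i).
Proof.
move=> [sZ sD] lam0 zX.
have s0 : s 0 = 0.
  by have := sZ 0 0 (lexx 0) (cone0 _ X); rewrite scale0r mul0r.
apply: (big_ind2 (fun (x : 'rV[R]_n) (r : R) => cone X x /\ s x <= r)).
- by rewrite s0; split=> //; exact: cone0.
- move=> x r y t [Xx sx] [Xy sy]; split; first exact: coneD.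
  by rewrite (le_trans (sD _ _ Xx Xy)) // lerD.
- move=> i Pi; have Xz := zX i Pi; split; first by apply: coneZ => //; exact: lam0.
  by rewrite sZ // lam0.
Qed.

Lemma dot_sublinear (R : realType) (n : nat) (K : set 'rV[R]_n) (a : 'rV[R]_n) :
  sublinear_on K (dot a).
Proof. by split=> [r x _ _ | x y _ _]; rewrite ?dotZr ?dotDr. Qed.

(** A linear form with all coefficients very negative lies below f on the
    nonzero points of X; at the origin it vanishes, whence the hypothesis. *)
Lemma minorant_exists (R : realType) (n : nat) (X : {set cube n}) (f : cube n -> R) :
  (cube0 \in X -> 0 <= f cube0) -> exists a, sublinear_minorant X f (dot a).
Proof.
move=> f0; pose M := \sum_v `|f v|.
have fM v : - M <= f v.
  rewrite lerNl (le_trans (ler_norm _)) // normrN /M (bigD1 v) //= lerDl.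
  exact: sumr_ge0.
exists (const_mx (- M)); split; first exact: dot_sublinear.
move=> v vX; case: (eqVneq v cube0) => [v0 | vn0].
  by rewrite v0 vec_cube0 dot0r f0 // -v0.
have [i vi] : exists i, v i.
  apply/existsP; apply: contraNT vn0 => /existsPn v0; apply/eqP/ffunP => i.
  by rewrite ffunE; exact/negbTE.
have M0 : 0 <= M by exact: sumr_ge0.
rewrite (le_trans _ (fM v)) // /dot (bigD1 i) //= !mxE vi mulr1 gerDl.
by apply: sumr_le0 => j _; rewrite !mxE mulr_le0_ge0 // oppr_le0.
Qed.

(** The largest sublinear minorant is the pointwise supremum of all of them.
    It is finite on the cone because a decomposition of a point into members of
    X bounds every minorant there. *)
Lemma sconvP (R : realType) (n : nat) (X : {set cube n}) (f : cube n -> R) :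
  (cube0 \in X -> 0 <= f cube0) -> is_sconv X f (sconv X f).
Proof.
move=> /minorant_exists[a ha].
pose Q x : set R := [set r | exists2 q, sublinear_minorant X f q & r = q x]%classic.
pose p x := sup (Q x).
have Q0 x : (Q x !=set0)%classic by exists (dot a x), (dot a).
have Qub x : cone X x -> has_ubound (Q x).
  move=> [lam [lam0 ->]]; exists (\sum_(v in X) lam v * f v) => _ [q [qs qf] ->].
  have [|_] := sublinear_comb (P := mem X) (lam := lam) (z := vec) qs (fun v _ => lam0 v).
    by move=> v; exact: cone_vec.
  move/le_trans; apply; apply: ler_sum => v vX.
  by rewrite ler_wpM2l ?lam0 ?qf.
have Qp q x : cone X x -> sublinear_minorant X f q -> q x <= p x.
  by move=> Xx hq; apply: ub_le_sup; [exact: Qub | exists q].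
have pQ x M : (forall q, sublinear_minorant X f q -> q x <= M) -> p x <= M.
  by move=> hM; apply: ge_sup => // _ [q hq ->]; exact: hM.
suff hp : is_sconv X f p by apply: xgetPex; exists p.
split; last by move=> q hq x Xx; exact: Qp.
split; last first.
  by move=> v vX; apply: pQ => q [_ qf]; exact: qf.
split=> [r x r0 Xx | x y Xx Xy].
  have Xrx : cone X (r *: x) by exact: coneZ.
  move: r0; rewrite le_eqVlt => /predU1P[r0 | r0].
    rewrite -r0 scale0r mul0r; apply/le_anti/andP; split.
      apply: pQ => q [[qZ _] _].
      by have := qZ 0 0 (lexx 0) (cone0 _ X); rewrite scale0r mul0r => ->.
    by have := Qp _ _ (cone0 _ X) ha; rewrite dot0r.
  apply/le_anti/andP; split.
    apply: pQ => q hq; have [[qZ _] _] := hq.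
    by rewrite qZ ?(ltW r0) // ler_pM2l // Qp.
  rewrite -ler_pdivlMl //; apply: pQ => q hq; have [[qZ _] _] := hq.
  by rewrite ler_pdivlMl // -qZ ?(ltW r0) // Qp.
apply: pQ => q hq; have [[_ qD] _] := hq.
by rewrite (le_trans (qD _ _ Xx Xy)) // lerD // Qp.
Qed.

(** * The theorem of the alternative for linear inequalities *)

(** The elimination step for one variable: all upper bounds lie above all lower
    bounds, so some value satisfies both. *)
Lemma between_finite_bounds (R : realFieldType) (J : finType) (P N : pred J)
    (lo hi : J -> R) :
  (forall i j, P i -> N j -> lo j <= hi i) ->
  exists t, (forall i, P i -> t <= hi i) /\ (forall j, N j -> lo j <= t).
Proof.
move=> lohi; case: (pickP N) => [j0 Nj0 | N0].
  case: (arg_maxP lo Nj0) => j Nj jmax; exists (lo j); split=> [i Pi|].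
    exact: lohi.
  exact: jmax.
case: (pickP P) => [i0 Pi0 | P0]; last first.
  by exists 0; split=> k; rewrite ?P0 ?N0.
case: (arg_minP hi Pi0) => i Pi imin; exists (hi i); split=> [|j].
  exact: imin.
by rewrite N0.
Qed.

(** Elimination of the last variable combines each pair of constraints on which
    it has coefficients of opposite signs and keeps the constraints in which it
    does not occur.  Indexing the new system by all of J * J, where a pair that
    is not combined repeats its first member or becomes 0 <= 0, keeps the index
    a finite type, and a certificate for the new system pulls back to the old
    one by summing over pairs. *)
Lemma fourier_motzkin (R : realFieldType) (n : nat) :
  forall (J : finType) (A : J -> nat -> R) (b : J -> R),
  (exists a : nat -> R, forall j, \sum_(i < n) a i * A j i <= b j) \/
  (exists y : J -> R, [/\ forall j, 0 <= y j,
     forall i, (i < n)%N -> \sum_j y j * A j i = 0 & \sum_j y j * b j < 0]).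
Proof.
elim: n => [|n IHn] J A b.
  case: (pickP (fun j => b j < 0)) => [j0 bj0 | b_ge0].
    right; exists (fun j => (j == j0)%:R); split=> //.
    rewrite (bigD1 j0) //= eqxx mul1r big1 ?addr0 // => j /negbTE->.
    by rewrite mul0r.
  left; exists (fun=> 0) => j; rewrite big_ord0 leNgt; exact/negbT/b_ge0.
pose e j := A j n.
pose c (k : J * J) : R :=
  if (0 < e k.1) && (e k.2 < 0) then - e k.2 else (e k.1 == 0)%:R.
pose d (k : J * J) : R := if (0 < e k.1) && (e k.2 < 0) then e k.1 else 0.
have c_ge0 k : 0 <= c k by rewrite /c; case: ifP => // /andP[_ ?]; lra.
have d_ge0 k : 0 <= d k by rewrite /d; case: ifP => // /andP[? _]; lra.
have cd k : c k * e k.1 + d k * e k.2 = 0.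
  rewrite /c /d; case: ifP => _; first by ring.
  by case: eqP => [->|_]; rewrite ?mul0r ?mulr0 addr0.
case: (IHn _ (fun k i => c k * A k.1 i + d k * A k.2 i)
             (fun k => c k * b k.1 + d k * b k.2)) => [[a ha] | [y [y_ge0 yA yb]]].
  (* The slacks r of the old system at the solution of the new one bound the
     eliminated variable by r j / e j, from above or from below. *)
  left; pose r j := b j - \sum_(i < n) a i * A j i.
  have hr k : 0 <= c k * r k.1 + d k * r k.2.
    have := ha k; rewrite /r !mulrBr !mulr_sumr -subr_ge0.
    under eq_bigr => i _ do rewrite mulrDr.
    rewrite big_split /=.
    rewrite (eq_bigr (fun i : 'I_n => c k * (a i * A k.1 i))); last first.
      by move=> *; ring.
    rewrite [in X in _ - (_ + X)](eq_bigr (fun i : 'I_n => d k * (a i * A k.2 i)));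
      last by move=> *; ring.
    by congr (0 <= _); ring.
  have [|t [tP tN]] := @between_finite_bounds R J (fun j => 0 < e j)
     (fun j => e j < 0) (fun j => r j / e j) (fun j => r j / e j).
    move=> i j ei ej; have := hr (i, j); rewrite /c /d /= ei ej /=.
    rewrite ler_pdivlMr // mulrAC ler_ndivrMr //; nra.
  exists (fun i => if i == n then t else a i) => j.
  rewrite big_ord_recr /= eqxx.
  rewrite (eq_bigr (fun i : 'I_n => a i * A j i)); last first.
    by move=> i _; rewrite (ltn_eqF (ltn_ord i)).
  rewrite -[A j n]/(e j) addrC -lerBrDr -/(r j).
  case: (ltrgt0P (e j)) => ej.
  - by have := tP j ej; rewrite ler_pdivlMr.
  - by have := tN j ej; rewrite ler_ndivrMr.
  - by have := hr (j, j); rewrite /c /d /= ej ltxx eqxx /= mulr0 mul1r mul0r addr0.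
right; exists (fun j => \sum_k (y (j, k) * c (j, k) + y (k, j) * d (k, j))).
have lift (u : J -> R) :
  \sum_j (\sum_k (y (j, k) * c (j, k) + y (k, j) * d (k, j))) * u j =
  \sum_k y k * (c k * u k.1 + d k * u k.2).
  transitivity (\sum_(k : J * J) y k * c k * u k.1 + \sum_(k : J * J) y k * d k * u k.2).
    under eq_bigr => j _ do rewrite big_split mulrDl !mulr_suml.
    rewrite big_split /=; congr (_ + _).
      by rewrite pair_bigA; apply: eq_bigr => -[].
    by rewrite exchange_big pair_bigA; apply: eq_bigr => -[].
  by rewrite -big_split; apply: eq_bigr => k _ /=; ring.
split=> [j | i | ].
- by apply: sumr_ge0 => k _; rewrite addr_ge0 ?mulr_ge0.
- rewrite ltnS leq_eqVlt lift => /predU1P[-> | /yA//].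
  by apply: big1 => k _; rewrite cd mulr0.
- by rewrite lift.
Qed.

Lemma farkas (R : realType) (n : nat) (J : finType) (A : J -> 'rV[R]_n) (b : J -> R) :
  (exists a, forall j, dot a (A j) <= b j) \/
  (exists y : J -> R, [/\ forall j, 0 <= y j,
     \sum_j y j *: A j = 0 & \sum_j y j * b j < 0]).
Proof.
pose A' j i := if insub i is Some k then A j 0 k else 0.
have A'E j (i : 'I_n) : A' j i = A j 0 i by rewrite /A' valK.
case: (fourier_motzkin n A' b) => [[a ha] | [y [y_ge0 yA yb]]].
  left; exists (\row_i a i) => j; apply: le_trans (ha j).
  by rewrite /dot; under eq_bigr => i _ do rewrite mxE -A'E.
right; exists y; split=> //; apply/rowP => i.
rewrite summxE mxE -[RHS](yA i) //; apply: eq_bigr => j _.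
by rewrite mxE A'E.
Qed.

(** * Submodularity of the Dilworth truncation *)

Lemma vmeet_eq0 (n : nat) (x y : cube n) :
  vmeet x y = cube0 <-> forall i, x i && y i = false.
Proof.
split=> [xy0 i | xy0]; last by apply/ffunP => i; rewrite !ffunE.
by have /ffunP/(_ i) := xy0; rewrite !ffunE.
Qed.

Lemma sums_toP (n : nat) (V : {set cube n}) (x : cube n) :
  reflect (forall i, (\sum_(v in V) v i)%N = x i) (sums_to V x).
Proof. exact: 'forall_eqP. Qed.

Lemma sums_to_le (n : nat) (V : {set cube n}) (x v : cube n) i :
  sums_to V x -> v \in V -> v i -> x i.
Proof.
move=> /sums_toP/(_ i) Vx vV vi; move: Vx.
by rewrite (bigD1 v) //= vi; case: (x i).
Qed.

Lemma big_disjointU (T : finType) (M : nmodType) (V W : {set T}) (F : T -> M) :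
  [disjoint V & W] ->
  \sum_(v in V :|: W) F v = \sum_(v in V) F v + \sum_(v in W) F v.
Proof.
move=> VW; rewrite -bigU //=; apply: eq_bigl => v.
by rewrite !inE.
Qed.

Lemma sums_to_join (n : nat) (V W : {set cube n}) (x y : cube n) :
  cube0 \notin V -> sums_to V x -> sums_to W y -> vmeet x y = cube0 ->
  [disjoint V & W] /\ sums_to (V :|: W) (vjoin x y).
Proof.
move=> V0 Vx Wy /vmeet_eq0 xy0.
have VW : [disjoint V & W].
  apply/pred0P => v /=; apply/negP => /andP[vV vW].
  have v0 : v = cube0.
    apply/ffunP => i; rewrite ffunE; apply/negP => vi.
    by have := xy0 i; rewrite (sums_to_le Vx vV vi) (sums_to_le Wy vW vi).
  by rewrite -v0 vV in V0.
split=> //; apply/sums_toP => i; rewrite big_disjointU //=.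
move/sums_toP/(_ i): Vx => ->; move/sums_toP/(_ i): Wy => ->.
by have := xy0 i; rewrite ffunE; case: (x i); case: (y i).
Qed.

Definition vdiff {n : nat} (x y : cube n) : cube n := [ffun i => x i && ~~ y i].

Lemma sums_to_remove (n : nat) (V : {set cube n}) (x v : cube n) :
  sums_to V x -> v \in V -> sums_to (V :\ v) (vdiff x v).
Proof.
move=> Vx vV; apply/sums_toP => i.
move/sums_toP/(_ i): (Vx); rewrite (big_setD1 v) //= ffunE.
by case: (v i) => /=; rewrite ?andbT //; case: (x i) => //= -[].
Qed.

(** The minimizer does not depend on the default value given to the arg min, so
    any feasible V can serve as the witness that the constraint is
    satisfiable. *)
Lemma dilworth_argmin (R : realType) (n : nat) (X V : {set cube n})
    (g : cube n -> R) (x : cube n) :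
  V \subset X -> sums_to V x -> x != cube0 ->
  exists2 W : {set cube n}, (W \subset X) && sums_to W x &
    dilworth X g x = \sum_(v in W) g v /\
    (forall U : {set cube n}, U \subset X -> sums_to U x ->
       dilworth X g x <= \sum_(v in U) g v).
Proof.
move=> VX Vx /negbTE x0; rewrite /dilworth x0 /=.
pose P (U : {set cube n}) := (U \subset X) && sums_to U x.
pose cost (U : {set cube n}) := \sum_(v in U) g v.
have PV : P V by rewrite /P VX.
rewrite /Order.arg_min /extremum; case: pickP => [W /andP[PW /forallP Wmin] | no] /=.
  exists W => //; split=> // U UX Ux.
  by have := Wmin U; rewrite UX Ux.
case: (arg_minP cost PV) => W PW Wmin.
have := no W; rewrite /= -/(P W) PW /=; move/negbT/forallP; case=> U.
by apply/implyP; exact: Wmin.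
Qed.

Lemma dilworth0 (R : realType) (n : nat) (X : {set cube n}) (g : cube n -> R) :
  dilworth X g cube0 = 0.
Proof. by rewrite /dilworth eqxx. Qed.

Lemma dilworth_dom0 (n : nat) (X : {set cube n}) : dilworth_dom X cube0.
Proof.
apply/existsP; exists finset.set0; rewrite finset.sub0set; apply/sums_toP => i.
by rewrite big_set0 ffunE.
Qed.

Lemma sums_to_set1 (n : nat) (v : cube n) : sums_to [set v]%SET v.
Proof. by apply/sums_toP => i; rewrite big_set1. Qed.

Lemma dilworth_dom_mem (n : nat) (X : {set cube n}) v : v \in X -> dilworth_dom X v.
Proof.
move=> vX; apply/existsP; exists [set v]%SET.
by rewrite finset.sub1set vX sums_to_set1.
Qed.

Lemma dilworth_le_cost (R : realType) (n : nat) (X : {set cube n})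
    (g : cube n -> R) (h0 : cube0 \in X -> 0 <= g cube0) (V : {set cube n}) x :
  V \subset X -> sums_to V x -> dilworth X g x <= \sum_(v in V) g v.
Proof.
move=> VX Vx; case: (eqVneq x cube0) => [x0 | xn0]; last first.
  by have [W _ [_ /(_ V VX Vx)]] := dilworth_argmin g VX Vx xn0.
rewrite x0 dilworth0; apply: sumr_ge0 => v vV.
have -> : v = cube0.
  apply/ffunP => i; rewrite ffunE; apply/negP => vi.
  by have := sums_to_le Vx vV vi; rewrite x0 ffunE.
apply: h0; move/fintype.subsetP: VX; apply.
rewrite -(_ : v = cube0) //; apply/ffunP => i; rewrite ffunE; apply/negP => vi.
by have := sums_to_le Vx vV vi; rewrite x0 ffunE.
Qed.

(** An optimal decomposition may be assumed to avoid the zero vector, whose cost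
    is nonnegative.  Then the decompositions of two disjoint vectors have no
    common block, and their union is a decomposition. *)
Lemma dilworth_witness (R : realType) (n : nat) (X : {set cube n})
    (g : cube n -> R) (h0 : cube0 \in X -> 0 <= g cube0) x :
  dilworth_dom X x ->
  exists V : {set cube n}, [/\ V \subset X, sums_to V x, cube0 \notin V &
    dilworth X g x = \sum_(v in V) g v].
Proof.
case/existsP => U /andP[UX Ux]; case: (eqVneq x cube0) => [-> | xn0].
  exists finset.set0; rewrite finset.sub0set finset.in_set0 dilworth0 big_set0; split=> //.
  by apply/sums_toP => i; rewrite big_set0 ffunE.
have [W /andP[WX Wx] [hW _]] := dilworth_argmin g UX Ux xn0.
have W'x : sums_to (W :\ cube0) x.
  case: (boolP (cube0 \in W)) => W0; last first.
    suff -> : W :\ cube0 = W by [].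
    apply/finset.setP => v; rewrite finset.in_setD1.
    by case: eqP => // ->; rewrite (negbTE W0).
  have := sums_to_remove Wx W0; congr sums_to.
  by apply/ffunP => i; rewrite !ffunE andbT.
have W'X : W :\ cube0 \subset X by apply: fintype.subset_trans WX; exact: finset.subsetDl.
exists (W :\ cube0); rewrite W'X W'x finset.setD11; split=> //; apply/le_anti.
rewrite dilworth_le_cost //= hW.
case: (boolP (cube0 \in W)) => W0.
  rewrite [leRHS](big_setD1 _ W0) /= lerDr h0 //.
  exact: (fintype.subsetP WX).
suff -> : W :\ cube0 = W by [].
apply/finset.setP => v; rewrite finset.in_setD1.
by case: eqP => // ->; rewrite (negbTE W0).
Qed.

Lemma dilworth_le (R : realType) (n : nat) (X : {set cube n})
    (g : cube n -> R) (h0 : cube0 \in X -> 0 <= g cube0) v :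
  v \in X -> dilworth X g v <= g v.
Proof.
move=> vX; have := @dilworth_le_cost R n X g h0 [set v]%SET v.
by rewrite big_set1; apply; rewrite ?finset.sub1set ?sums_to_set1.
Qed.

Lemma dilworth_disjoint (R : realType) (n : nat) (X : {set cube n})
    (g : cube n -> R) (h0 : cube0 \in X -> 0 <= g cube0) x y :
  dilworth_dom X x -> dilworth_dom X y -> vmeet x y = cube0 ->
  dilworth_dom X (vjoin x y) /\
  dilworth X g (vjoin x y) <= dilworth X g x + dilworth X g y.
Proof.
move=> dx dy xy0.
have [V [VX Vx V0 ->]] := dilworth_witness h0 dx.
have [W [WX Wy _ ->]] := dilworth_witness h0 dy.
have [VW VWxy] := sums_to_join V0 Vx Wy xy0.
have VWX : V :|: W \subset X by rewrite finset.subUset VX.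
split; first by apply/existsP; exists (V :|: W); rewrite VWX.
rewrite (le_trans (dilworth_le_cost h0 VWX VWxy)) //.
by rewrite big_disjointU.
Qed.

Lemma dilworth_split (R : realType) (n : nat) (X : {set cube n})
    (g : cube n -> R) (h0 : cube0 \in X -> 0 <= g cube0) x :
  dilworth_dom X x -> x != cube0 ->
  exists u y, [/\ u \in X, u != cube0, dilworth_dom X y,
    vmeet u y = cube0 & x = vjoin u y /\ g u + dilworth X g y <= dilworth X g x].
Proof.
move=> dx xn0; have [V [VX Vx V0 ->]] := dilworth_witness h0 dx.
have [u uV] : exists u, u \in V.
  apply/existsP; apply: contraNT xn0 => /existsPn V00; apply/eqP/ffunP => i.
  have /sums_toP/(_ i) := Vx; rewrite big1 ?ffunE; first by case: (x i).
  by move=> v vV; have := V00 v; rewrite vV.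
have Vy := sums_to_remove Vx uV.
have VuX : V :\ u \subset X by apply: fintype.subset_trans VX; exact: finset.subsetDl.
exists u, (vdiff x u); split.
- exact: (fintype.subsetP VX).
- by apply: contraNneq V0 => <-.
- by apply/existsP; exists (V :\ u); rewrite VuX.
- by apply/vmeet_eq0 => i; rewrite ffunE; case: (u i); rewrite ?andbF.
split.
  apply/ffunP => i; rewrite !ffunE; have := @sums_to_le n V x u i Vx uV.
  by case: (u i) => [->|_] //=; rewrite andbT.
by rewrite (big_setD1 _ uV) lerD2l dilworth_le_cost.
Qed.

Lemma card_vjoin_lt (n : nat) (u y : cube n) : u != cube0 -> vmeet u y = cube0 ->
  (#|[set i | y i]%SET| < #|[set i | vjoin u y i]%SET|)%N.
Proof.
move=> un0 /vmeet_eq0 uy0; apply: proper_card; apply/properP; split.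
  by apply/fintype.subsetP => i; rewrite !finset.in_set ffunE => ->; rewrite orbT.
have [i ui] : exists i, u i.
  apply/existsP; apply: contraNT un0 => /existsPn u0; apply/eqP/ffunP => i.
  by rewrite ffunE; exact/negbTE.
exists i; rewrite !finset.in_set ?ffunE ?ui //.
by have := uy0 i; rewrite ui => /= ->.
Qed.

(** Induction on x, with a block u split off from it, x = u + y.  If u misses v,
    then u only contributes to the join.  Otherwise u is uncrossed with v, and
    the join of u and v takes the place of v in the induction: its meet with y
    is that of v, because u and y are disjoint. *)
Lemma dilworth_uncross_mem (R : realType) (n : nat) (X : {set cube n})
    (hX : intersecting_family X) (g : cube n -> R)
    (hg : intersecting_submodular X g) (h0 : cube0 \in X -> 0 <= g cube0) x v :
  dilworth_dom X x -> v \in X ->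
  [/\ dilworth_dom X (vjoin x v), dilworth_dom X (vmeet x v) &
      dilworth X g (vjoin x v) + dilworth X g (vmeet x v) <= dilworth X g x + g v].
Proof.
have [m] := ubnP #|[set i | x i]%SET|.
elim: m x v => // m IHm x v; rewrite ltnS => xm dx vX.
case: (eqVneq x cube0) => [-> | xn0].
  have -> : vjoin cube0 v = v by apply/ffunP => i; rewrite !ffunE.
  have -> : vmeet cube0 v = cube0 by apply/ffunP => i; rewrite !ffunE.
  rewrite dilworth0 addr0 add0r dilworth_dom0 dilworth_dom_mem //.
  by rewrite dilworth_le.
have [u [y [uX un0 dy uy0 [xE hxE]]]] := dilworth_split h0 dx xn0.
have ym : (#|[set i | y i]%SET| < m)%N.
  by apply: leq_trans xm; rewrite xE card_vjoin_lt.
have hu := dilworth_le h0 uX.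
case: (eqVneq (vmeet u v) cube0) => [uv0 | uvn0].
- have [djy dmy IH] := IHm y v ym dy vX.
  have d1 : vmeet u (vjoin y v) = cube0.
    apply/vmeet_eq0 => i; rewrite ffunE.
    move/vmeet_eq0/(_ i): uy0; move/vmeet_eq0/(_ i): uv0.
    by case: (u i); case: (y i); case: (v i).
  have [djx hjx] := dilworth_disjoint h0 (dilworth_dom_mem uX) djy d1.
  have -> : vjoin x v = vjoin u (vjoin y v).
    by rewrite xE; apply/ffunP => i; rewrite !ffunE orbA.
  have -> : vmeet x v = vmeet y v.
    rewrite xE; apply/ffunP => i; rewrite !ffunE.
    move/vmeet_eq0/(_ i): uv0.
    by case: (u i); case: (y i); case: (v i).
  by split=> //; lra.
- have /andP[jX mX] := hX u v uX vX uvn0.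
  have [djy dmy IH] := IHm y (vjoin u v) ym dy jX.
  have myE : vmeet y (vjoin u v) = vmeet y v.
    apply/ffunP => i; rewrite !ffunE; move/vmeet_eq0/(_ i): uy0.
    by case: (u i); case: (y i); case: (v i).
  rewrite myE in dmy IH.
  have d1 : vmeet (vmeet u v) (vmeet y v) = cube0.
    apply/vmeet_eq0 => i; rewrite !ffunE; move/vmeet_eq0/(_ i): uy0.
    by case: (u i); case: (y i); case: (v i).
  have [dmx hmx] := dilworth_disjoint h0 (dilworth_dom_mem mX) dmy d1.
  have -> : vjoin x v = vjoin y (vjoin u v).
    by rewrite xE; apply/ffunP => i; rewrite !ffunE orbCA -orbA.
  have -> : vmeet x v = vjoin (vmeet u v) (vmeet y v).
    by rewrite xE; apply/ffunP => i; rewrite !ffunE andb_orl.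
  have := dilworth_le h0 mX; have := hg u v uX vX uvn0.
  by split=> //; lra.
Qed.

(** The blocks v of a decomposition of y are merged into x one at a time.  The
    meets of the blocks with x are not affected by the blocks merged before,
    which are disjoint from v, so in the end they add up to a decomposition of
    the meet of x and y. *)
Lemma dilworth_submodular (R : realType) (n : nat) (X : {set cube n})
    (hX : intersecting_family X) (g : cube n -> R)
    (hg : intersecting_submodular X g) (h0 : cube0 \in X -> 0 <= g cube0) x y :
  dilworth_dom X x -> dilworth_dom X y ->
  [/\ dilworth_dom X (vjoin x y), dilworth_dom X (vmeet x y) &
      dilworth X g (vjoin x y) + dilworth X g (vmeet x y)
        <= dilworth X g x + dilworth X g y].
Proof.
have [m] := ubnP #|[set i | y i]%SET|.
elim: m x y => // m IHm x y; rewrite ltnS => ym dx dy.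
case: (eqVneq y cube0) => [-> | yn0].
  have -> : vjoin x cube0 = x by apply/ffunP => i; rewrite !ffunE orbF.
  have -> : vmeet x cube0 = cube0 by apply/ffunP => i; rewrite !ffunE andbF.
  by rewrite dilworth_dom0.
have [v [z [vX vn0 dz vz0 [yE hyE]]]] := dilworth_split h0 dy yn0.
have [djv dmv hv] := dilworth_uncross_mem hX hg h0 dx vX.
have zm : (#|[set i | z i]%SET| < m)%N.
  by apply: leq_trans ym; rewrite yE card_vjoin_lt.
have [djz dmz IH] := IHm (vjoin x v) z zm djv dz.
have mE : vmeet (vjoin x v) z = vmeet x z.
  apply/ffunP => i; rewrite !ffunE; move/vmeet_eq0/(_ i): vz0.
  by case: (x i); case: (z i); case: (v i).
rewrite mE in dmz IH.
have d1 : vmeet (vmeet x v) (vmeet x z) = cube0.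
  apply/vmeet_eq0 => i; rewrite !ffunE; move/vmeet_eq0/(_ i): vz0.
  by case: (x i); case: (z i); case: (v i).
have [dm hm] := dilworth_disjoint h0 dmv dmz d1.
have -> : vjoin x y = vjoin (vjoin x v) z.
  by rewrite yE; apply/ffunP => i; rewrite !ffunE orbA.
have -> : vmeet x y = vjoin (vmeet x v) (vmeet x z).
  by rewrite yE; apply/ffunP => i; rewrite !ffunE andb_orr.
by split=> //; lra.
Qed.

(** * The retraction and the submodularity of the extension *)

Lemma retractionP (n : nat) (I0 : {set 'I_n}) (D : rel 'I_n) (x : cube n) i :
  reflect (exists j, [/\ D i j, x j & j \notin I0]) (retraction I0 D x i).
Proof.
rewrite ffunE big_orE; apply: (iffP existsP) => [[j /andP[Dij]] | [j [Dij xj jI]]].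
  by rewrite !ffunE => /andP[xj jI]; exists j.
by exists j; rewrite Dij !ffunE xj jI.
Qed.

Lemma retraction_join (n : nat) (I0 : {set 'I_n}) (D : rel 'I_n) (x y : cube n) :
  retraction I0 D (vjoin x y) = vjoin (retraction I0 D x) (retraction I0 D y).
Proof.
apply/ffunP => i; rewrite [RHS]ffunE; apply/retractionP/orP.
  move=> [j [Dij]]; rewrite ffunE => /orP[xj | yj] jI; [left | right];
    by apply/retractionP; exists j.
by move=> [] /retractionP[j [Dij xj jI]]; exists j; rewrite ffunE xj ?orbT.
Qed.

Lemma retraction_meet (n : nat) (I0 : {set 'I_n}) (D : rel 'I_n) (x y : cube n) i :
  retraction I0 D (vmeet x y) i -> retraction I0 D x i && retraction I0 D y i.
Proof.
move=> /retractionP[j [Dij]]; rewrite ffunE => /andP[xj yj] jI.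
by apply/andP; split; apply/retractionP; exists j.
Qed.

Lemma retraction_ge (n : nat) (Y : pred (cube n)) (I0 : {set 'I_n}) (D : rel 'I_n)
    (hD : preorder_representation Y I0 D) (x : cube n) i :
  i \notin I0 -> x i -> retraction I0 D x i.
Proof. by move=> iI xi; apply/retractionP; exists i; case: hD => ->. Qed.

Lemma retraction_I0 (n : nat) (Y : pred (cube n)) (I0 : {set 'I_n}) (D : rel 'I_n)
    (hD : preorder_representation Y I0 D) (x : cube n) i :
  i \in I0 -> retraction I0 D x i = false.
Proof.
move=> iI; apply/negP => /retractionP[j [Dij _]] /negP; apply.
by case: hD => _ _ + _; apply; [exact: Dij |].
Qed.

Lemma retraction_mem (n : nat) (Y : pred (cube n)) (I0 : {set 'I_n}) (D : rel 'I_n)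
    (hD : preorder_representation Y I0 D) (x : cube n) : Y (retraction I0 D x).
Proof.
have [_ Dtr _ YE] := hD; apply/YE; split=> [i | i j Dij].
  exact: (retraction_I0 hD).
case: (boolP (retraction I0 D x j)) => // /retractionP[k [Djk xk kI]].
suff -> : retraction I0 D x i by [].
by apply/retractionP; exists k; split=> //; exact: Dtr Djk.
Qed.

Lemma retraction_id (n : nat) (Y : pred (cube n)) (I0 : {set 'I_n}) (D : rel 'I_n)
    (hD : preorder_representation Y I0 D) (x : cube n) :
  Y x -> retraction I0 D x = x.
Proof.
have [_ _ _ YE] := hD => /YE[x0 xD]; apply/ffunP => i; apply/retractionP/idP.
  by move=> [j [Dij xj _]]; have := xD i j Dij; rewrite xj; case: (x i).
move=> xi; have iI : i \notin I0 by apply/negP => /x0; rewrite xi.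
by exists i; case: hD => ->.
Qed.

(** A coordinate in I0 contributes its own value to the distance, which is
    modular.  Elsewhere the distance counts the elements that the retraction
    adds; it would be modular too if the retraction preserved meets, and the
    third term on the left corrects for the elements that it loses there. *)
Lemma dist1_retraction (R : realType) (n : nat) (Y : pred (cube n))
    (I0 : {set 'I_n}) (D : rel 'I_n) (hD : preorder_representation Y I0 D)
    (x y : cube n) (r := retraction I0 D) :
  dist1 (vjoin x y) (r (vjoin x y)) + dist1 (vmeet x y) (r (vmeet x y))
    + dist1 (vmeet (r x) (r y)) (r (vmeet x y))
  = dist1 x (r x) + dist1 y (r y) :> R.
Proof.
rewrite /dist1 -!big_split; apply: eq_bigr => i _ /=.
rewrite /r retraction_join -/r.
have := @retraction_meet n I0 D x y i.
have := @retraction_ge n Y I0 D hD x i; have := @retraction_ge n Y I0 D hD y i.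
have := @retraction_ge n Y I0 D hD (vmeet x y) i.
have := @retraction_I0 n Y I0 D hD x i; have := @retraction_I0 n Y I0 D hD y i.
have jE (u v : cube n) : vjoin u v i = u i || v i by rewrite ffunE.
have mE (u v : cube n) : vmeet u v i = u i && v i by rewrite ffunE.
rewrite -!/(r _) !(jE, mE).
case: (i \in I0) => /=.
  move=> -> // -> // _ _ _; case: (r _ i) => [/(_ isT)//|_].
  by case: (x i); case: (y i); rewrite /= ?subrr ?subr0 ?normr0 ?normr1; lra.
move=> _ _ + + + +.
by case: (x i) => /=; case: (y i) => /=; case: (r x i) => /=; case: (r y i) => /=;
  case: (r _ i) => /= h1 h2 h3 h4;
  rewrite ?subrr ?subr0 ?sub0r ?normrN ?normr0 ?normr1;
  do ?[by have := h1 isT isT | by have := h2 isT isT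
      |by have := h3 isT isT | by have := h4 isT]; lra.
Qed.

Lemma dist1_ge1 (R : realType) (n : nat) (x y : cube n) :
  x != y -> 1 <= dist1 x y :> R.
Proof.
move=> xy; have [i xyi] : exists i, x i != y i.
  apply/existsP; apply: contraNT xy => /existsPn xy; apply/eqP/ffunP => i.
  by have := xy i; rewrite negbK => /eqP.
rewrite /dist1 (bigD1 i) //= (_ : `|_| = 1) ?lerDl ?sumr_ge0 //.
by case: (x i) (y i) xyi => [] [] //= _; rewrite ?subr0 ?sub0r ?normrN normr1.
Qed.

(** Submodularity of the truncation at the retractions of x and y leaves the
    error h (rho (x /\ y)) - h (rho x /\ rho y).  It vanishes if
    the retraction preserves this meet; otherwise it is at most fU - fL, and the
    sum of the distances decreases by at least 1. *)
Lemma extension_submodular (R : realType) (n : nat) (X : {set cube n})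
    (I0 : {set 'I_n}) (D : rel 'I_n)
    (hD : preorder_representation (dilworth_dom X) I0 D) (fL fU : R)
    (g : cube n -> R)
    (hsub : forall x y, dilworth_dom X x -> dilworth_dom X y ->
      dilworth_dom X (vmeet x y) /\
      dilworth X g (vjoin x y) + dilworth X g (vmeet x y)
        <= dilworth X g x + dilworth X g y)
    (hbnd : forall x, dilworth_dom X x -> fL <= dilworth X g x <= fU) :
  submodular (extension X I0 D fL fU g).
Proof.
move=> x y; rewrite /extension; set C := _ * (fU - fL); set r := retraction I0 D.
have /(congr1 ( *%R C)) := dist1_retraction R hD x y; rewrite -/r !mulrDr => distE.
have rY z : dilworth_dom X (r z) by exact: retraction_mem hD z.
have [mY sub] := hsub _ _ (rY x) (rY y).
have rj : r (vjoin x y) = vjoin (r x) (r y) by exact: retraction_join.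
have gap : dilworth X g (r (vmeet x y)) - dilworth X g (vmeet (r x) (r y))
   <= C * dist1 (vmeet (r x) (r y)) (r (vmeet x y)).
  case: (eqVneq (vmeet (r x) (r y)) (r (vmeet x y))) => [-> | ne].
    rewrite subrr (_ : dist1 _ _ = 0) ?mulr0 //.
    by apply: big1 => i _; rewrite subrr normr0.
  have n_gt0 : (0 < n)%N.
    rewrite lt0n; apply: contraNneq ne => n0; apply/eqP/ffunP => i.
    by have := ltn_ord i; rewrite [X in (_ < X)%N]n0.
  have /andP[l1 u1] := hbnd _ (rY (vmeet x y)); have /andP[l2 u2] := hbnd _ mY.
  have LU : 0 <= fU - fL by lra.
  have C0 : fU - fL <= C.
    by rewrite /C ler_peMl // exprn_ege1 // ler1n.
  have := @dist1_ge1 R n _ _ ne; move: (dist1 _ _) => d d1.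
  apply: le_trans (_ : C * 1 <= _); first by lra.
  by rewrite ler_wpM2l //; lra.
by rewrite rj in distE *; lra.
Qed.

(** * The greedy algorithm on a lattice family *)

(** The greedy algorithm, run downwards from a member c of the lattice
    family.  Let m be the minimum of p on c, and d a maximal member that is
    strictly below c and contains the points where p exceeds m.  The form for d
    and p - m 1_c gets one more nonzero coefficient, g c - g d, placed at a
    single element r of c outside d; this makes it tight at c.  Maximality of d
    means that a member v below c either lies below d or satisfies v \/ d = c,
    and in the latter case submodularity at v and d extends the bound to v.  The
    members met on the way form a chain that decomposes p and on which the form
    is tight, so the form dominates every sublinear minorant at p. *)
Lemma chain_greedy (R : realType) (n : nat) (L : {set cube n}) (g : cube n -> R)
    (M : R) (L0 : cube0 \in L)
    (Lj : forall x y, x \in L -> y \in L -> vjoin x y \in L)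
    (Lm : forall x y, x \in L -> y \in L -> vmeet x y \in L)
    (gsub : forall x y, x \in L -> y \in L ->
       g (vjoin x y) + g (vmeet x y) <= g x + g y)
    (g0 : g cube0 = 0)
    (gM : forall x y, x \in L -> y \in L -> g x - g y <= M)
    (c : cube n) (p : 'rV[R]_n) :
  c \in L -> (forall i, 0 <= p 0 i) -> (forall i, ~~ c i -> p 0 i = 0) ->
  (forall t, 0 <= t -> [ffun i => t < p 0 i] \in L) ->
  exists a : 'rV[R]_n,
    [/\ forall i, ~~ c i -> a 0 i = 0, dot a (vec c) = g c,
        forall v, v \in L -> (forall i, v i -> c i) -> dot a (vec v) <= g v,
        forall i, `|a 0 i| <= M &
        cone L p /\ forall s, sublinear_minorant L g s -> s p <= dot a p].
Proof.
have M0 : 0 <= M by rewrite -(subrr (g cube0)) gM.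
have [k] := ubnP #|[set i | c i]%SET|.
elim: k c p => // k IHk c p; rewrite ltnS => ck cL p0 pc pL.
case: (eqVneq c cube0) => [c0 | cn0].
  have pE : p = 0 by apply/rowP => i; rewrite pc ?mxE // c0 ffunE.
  exists 0; split=> [i _ | | v _ vc | i |].
  - by rewrite mxE.
  - by rewrite c0 vec_cube0 dot0r.
  - rewrite (_ : v = cube0) ?vec_cube0 ?dot0r ?g0 //.
    by apply/ffunP => i; rewrite ffunE; apply/negP => /vc; rewrite c0 ffunE.
  - by rewrite mxE normr0.
  rewrite pE; split; first exact: cone0.
  move=> s [[sZ _] _]; rewrite dot0r.
  by have := sZ 0 0 (lexx 0) (cone0 _ L); rewrite scale0r mul0r => ->.
have [i0 ci0] : exists i, c i.
  apply/existsP; apply: contraNT cn0 => /existsPn c00; apply/eqP/ffunP => i.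
  by rewrite ffunE; exact/negbTE.
case: (arg_minP (fun i => p 0 i) (ci0 : (fun i => c i) i0)) => r1 cr1 r1min.
set m := p 0 r1 in r1min.
pose b : cube n := [ffun i => m < p 0 i].
have bL : b \in L by apply: pL; exact: p0.
pose P (d : cube n) :=
  [&& d \in L, d != c, [forall i, d i ==> c i] & [forall i, b i ==> d i]].
have Pb : P b.
  apply/and4P; split=> //.
  - by apply: contraTneq cr1 => <-; rewrite ffunE ltxx.
  - apply/forallP => i; apply/implyP; rewrite ffunE => mi; apply: contraLR mi => /pc->.
    by rewrite -leNgt; exact: p0.
  - by apply/forallP => i; exact/implyP.
case: (arg_maxnP (fun d : cube n => #|[set i | d i]%SET|) Pb) => d.
move=> /and4P[dL dc /forallP dlec /forallP bled] dmax.
have {}dlec i : d i -> c i by move: (dlec i) => /implyP.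
have {}bled i : b i -> d i by move: (bled i) => /implyP.
have dcov v : v \in L -> (forall i, v i -> c i) -> vjoin v d = d \/ vjoin v d = c.
  move=> vL vc; case: (eqVneq (vjoin v d) c) => [|ne]; [by right | left]. 
  have Pvd : P (vjoin v d).
    apply/and4P; split=> //; first exact: Lj.
      by apply/forallP => i; apply/implyP; rewrite ffunE => /orP[/vc | /dlec].
    by apply/forallP => i; apply/implyP => /bled di; rewrite ffunE di orbT.
  have sub : [set i | d i]%SET \subset [set i | vjoin v d i]%SET.
    by apply/fintype.subsetP => i; rewrite !finset.in_set ffunE => ->; rewrite orbT.
  have /eqP/finset.setP E : [set i | d i]%SET == [set i | vjoin v d i]%SET.
    by rewrite eqEcard sub; exact: dmax.
  by apply/ffunP => i; have := E i; rewrite !finset.in_set.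
have [r cr dr] : exists2 r, c r & ~~ d r.
  apply: contrapT => nr; case/eqP: dc; apply/ffunP => i.
  apply/idP/idP; first exact: dlec.
  by move=> ci; apply/negPn/negP => di; apply: nr; exists i.
have pr i : c i -> ~~ d i -> p 0 i = m.
  move=> ci di; apply/le_anti; rewrite r1min // andbT leNgt.
  by apply: contra di => mi; apply: bled; rewrite ffunE.
pose p' := p - m *: vec c.
have p'E i : p' 0 i = p 0 i - m * (c i)%:R by rewrite !mxE.
have dk : (#|[set i | d i]%SET| < k)%N.
  apply: leq_trans ck; apply: proper_card; apply/properP; split.
    by apply/fintype.subsetP => i; rewrite !finset.in_set => /dlec.
  by exists r; rewrite !finset.in_set.
have m0 : 0 <= m by exact: p0.
have [||| a' [a'd a'g a'le a'M [p'cone p's]]] := IHk d p' dk dL.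
- move=> i; rewrite p'E; case: (boolP (c i)) => ci; last by rewrite mulr0 subr0.
  by rewrite mulr1 subr_ge0 r1min.
- move=> i di; rewrite p'E; case: (boolP (c i)) => ci.
    by rewrite pr // mulr1 subrr.
  by rewrite mulr0 subr0 pc.
- move=> t t0; have := pL (m + t) (addr_ge0 m0 t0).
  congr (_ \in L); apply/ffunP => i; rewrite !ffunE p'E.
  case: (boolP (c i)) => ci; first by rewrite mulr1 ltrBrDl.
  by rewrite mulr0 subr0 pc // !ltNge t0 addr_ge0.
(* The new coefficient sits outside d, where a' and p' vanish. *)
pose a := a' + (g c - g d) *: delta_mx 0 r.
have aE i : a 0 i = a' 0 i + (g c - g d) * (i == r)%:R by rewrite !mxE eqxx.
have dota x : dot a x = dot a' x + (g c - g d) * x 0 r.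
  rewrite /a dotDl; congr (_ + _); rewrite dotC dotZr dotC; congr (_ * _).
  rewrite /dot (bigD1 r) //= big1 ?addr0 => [|i /negbTE ir]; rewrite mxE.
    by rewrite !eqxx mul1r.
  by rewrite ir andbF mul0r.
have a'meet (v : cube n) : (forall i, v i -> c i) -> dot a' (vec v) = dot a' (vec (vmeet v d)).
  move=> vc; apply: eq_bigr => i _; rewrite !mxE ffunE.
  by case: (boolP (d i)) => di; rewrite ?andbT // a'd // !mul0r.
have ac : dot a (vec c) = g c.
  rewrite dota mxE cr mulr1 a'meet // (_ : vmeet c d = d) ?a'g; first by ring.
  by apply/ffunP => i; rewrite ffunE; case: (boolP (d i)) => [/dlec->|]; rewrite ?andbF.
exists a; split=> // [i ci | v vL vc | i |].
- rewrite aE a'd; last by apply: contra ci => /dlec.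
  by case: eqP ci => [->|_ _]; rewrite ?cr // mulr0 addr0.
- have mL := Lm _ _ vL dL.
  have a'v : dot a' (vec (vmeet v d)) <= g (vmeet v d).
    by apply: a'le => // i; rewrite ffunE => /andP[].
  rewrite dota a'meet // mxE; case: (dcov v vL vc) => vd.
    have vr : v r = false.
      by have := congr1 (fun w : cube n => w r) vd; rewrite /= ffunE (negbTE dr) orbF.
    rewrite vr mulr0 addr0 (le_trans a'v) // (_ : vmeet v d = v) //.
    apply/ffunP => i; rewrite ffunE.
    have := congr1 (fun w : cube n => w i) vd; rewrite /= ffunE.
    by case: (v i) => //= <-.
  have vr : v r.
    by have := congr1 (fun w : cube n => w r) vd; rewrite /= ffunE (negbTE dr) orbF cr.
  by have := gsub _ _ vL dL; rewrite vd vr mulr1; lra.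
- rewrite aE; case: eqP => [->|_]; last by rewrite mulr0 addr0.
  by rewrite a'd // add0r mulr1 ler_norml gM // lerNl opprB gM.
have pE : p = p' + m *: vec c by rewrite /p' subrK.
have cc := cone_vec R cL.
have mcc := coneZ m0 cc.
split; first by rewrite pE; exact: coneD.
move=> s hs; have [[sZ sD] sg] := hs.
rewrite pE (le_trans (sD _ _ p'cone mcc)) // dotDr dotZr ac sZ //.
rewrite lerD ?ler_wpM2l ?sg // (le_trans (p's s hs)) // dota p'E cr pr // mulr1 subrr.
by rewrite mulr0 addr0.
Qed.

(** * Splitting a vector into two monotone vectors *)

(** The cone generated by the family that I0 and D represent: a nonnegative p
    belongs to it iff all its level sets {i | t < p_i} with t >= 0 belong to the
    family. *)
Definition monotone_vec {R : realType} {n : nat} (I0 : {set 'I_n}) (D : rel 'I_n)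
    (p : 'rV[R]_n) : Prop :=
  [/\ forall i, 0 <= p 0 i, forall i, i \in I0 -> p 0 i = 0 &
      forall i j, D i j -> p 0 j <= p 0 i].

(** Starting from t = 0 and moving on from t to the value d u that the
    hypothesis provides, each step has length at most c u, no index u is met
    twice, and the walk ends above every value of d. *)
Lemma gap_bound (R : realDomainType) (I : finType) (d c : I -> R)
    (c0 : forall u, 0 <= c u)
    (gap : forall t, 0 <= t -> (exists u, t < d u) ->
       exists u, t < d u <= t + c u) (w : I) :
  d w <= \sum_u c u.
Proof.
suff H t : 0 <= t -> d w <= t + \sum_(u | t < d u) c u.
  apply: le_trans (H 0 (lexx 0)) _; rewrite add0r big_mkcond /=.
  by apply: ler_sum => u _; case: ifP.
have [k] := ubnP #|[set u | t < d u]%SET|.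
elim: k t => // k IHk t; rewrite ltnS => tk t0.
case: (lerP (d w) t) => [wt | wt].
  by rewrite (le_trans wt) // lerDl sumr_ge0.
have [u /andP[tu utc]] := gap t t0 (ex_intro _ w wt).
apply: le_trans (IHk (d u) _ (le_trans t0 (ltW tu))) _.
  apply: leq_trans tk; apply: proper_card; apply/properP; split.
    by apply/fintype.subsetP => v; rewrite !finset.in_set; exact: lt_trans.
  by exists u; rewrite !finset.in_set // ltxx.
rewrite [in leRHS](bigD1 u) //= addrA lerD //.
rewrite [leLHS]big_mkcond [leRHS]big_mkcond /=; apply: ler_sum => v _.
case: (ltrP (d u) (d v)) => uv; last by case: ifP.
by rewrite (lt_trans tu uv) /= (contraTneq _ uv) // => ->; rewrite ltxx.
Qed.

(** The conditions on a are closed under suprema, so there is a largest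
    admissible a below p.  Suppose that, for some t >= 0, the difference
    p_u - a_u exceeds t + c_u at all u of the nonempty set U where it exceeds t.
    Then a can be raised slightly on U, because the monotonicity of p and of
    q = x + c - p makes the constraints between U and its complement slack.
    That contradicts maximality, so [gap_bound] applies to p - a. *)
Lemma monotone_split (R : realType) (n : nat) (I0 : {set 'I_n}) (D : rel 'I_n)
    (p q x : 'rV[R]_n) (c : 'I_n -> R) :
  monotone_vec I0 D p -> monotone_vec I0 D q -> monotone_vec I0 D x ->
  (forall i, 0 <= c i) -> (forall i, p 0 i + q 0 i = x 0 i + c i) ->
  exists a, [/\ monotone_vec I0 D a, monotone_vec I0 D (x - a) &
    forall i, a 0 i <= p 0 i <= a 0 i + \sum_j c j].
Proof.
move=> [p0 pI pD] [q0 qI qD] [x0 xI xD] c0 pq.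
pose F (b : 'rV[R]_n) := [/\ monotone_vec I0 D b, monotone_vec I0 D (x - b) &
  forall i, b 0 i <= p 0 i].
pose S i : set R := [set t | exists2 b, F b & t = b 0 i]%classic.
have F0 : F 0.
  split=> [||i]; rewrite ?subr0 ?mxE //.
  by split=> [i | i _ | i j _]; rewrite !mxE.
have Sne i : (S i !=set0)%classic by exists 0; exists 0; rewrite ?mxE.
have Sub i : has_ubound (S i) by exists (p 0 i) => _ [b [_ _ bp] ->].
pose a : 'rV[R]_n := \row_i sup (S i).
have Fa b i : F b -> b 0 i <= a 0 i.
  by move=> Fb; rewrite mxE; apply: ub_le_sup => //; exists b.
have aF i M : (forall b, F b -> b 0 i <= M) -> a 0 i <= M.
  by move=> hM; rewrite mxE; apply: ge_sup => // _ [b Fb ->]; exact: hM.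
have xbE (b : 'rV[R]_n) i : (x - b) 0 i = x 0 i - b 0 i by rewrite !mxE.
have Fmax : F a.
  split=> [||i]; last by apply: aF => b [].
    split=> [i | i iI | i j Dij].
    - by rewrite (le_trans _ (Fa 0 i F0)) ?mxE.
    - apply/le_anti/andP; split; first by apply: aF => b [[_ + _] _ _] => ->.
      by rewrite (le_trans _ (Fa 0 i F0)) ?mxE.
    - apply: aF => b Fb; have [[_ _ bD] _ _] := Fb.
      exact: le_trans (bD _ _ Dij) (Fa b i Fb).
  split=> [i | i iI | i j Dij]; rewrite ?xbE.
  - rewrite subr_ge0; apply: aF => b [_ [+ _ _] _] => /(_ i).
    by rewrite xbE subr_ge0.
  - rewrite xI // sub0r; apply/eqP; rewrite oppr_eq0; apply/eqP/le_anti/andP; split.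
      by apply: aF => b [[_ + _] _ _] => ->.
    by rewrite (le_trans _ (Fa 0 i F0)) ?mxE.
  - suff : a 0 i <= x 0 i - (x 0 j - a 0 j) by lra.
    apply: aF => b Fb; have [_ [_ _ xbD] _] := Fb.
    by have := xbD _ _ Dij; have := Fa b j Fb; rewrite !xbE; lra.
have [[a0 aI aD] [xa0 xaI xaD] ap] := Fmax.
exists a; split=> // w; rewrite ap /= -lerBlDl.
apply: (@gap_bound R _ (fun u => p 0 u - a 0 u)) => // t t0 [u0 u0t].
(* u has the least excess of p - a over c on U = {v | t < p_v - a_v}. *)
case: (arg_minP (fun u => p 0 u - a 0 u - c u)
         (u0t : (fun u => t < p 0 u - a 0 u) u0)) => u ut umin.
exists u; rewrite ut /= leNgt; apply/negP => uc.
pose e := p 0 u - a 0 u - c u - t.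
have e0 : 0 < e by rewrite /e; lra.
pose U i := t < p 0 i - a 0 i.
have Ue i : U i -> t + c i + e <= p 0 i - a 0 i by move=> /umin /=; rewrite /e; lra.
pose b : 'rV[R]_n := \row_i (a 0 i + e * (U i)%:R).
have bE i : b 0 i = a 0 i + e * (U i)%:R by rewrite mxE.
suff Fb : F b.
  by have := Fa b u Fb; rewrite bE {1}/U ut mulr1; lra.
have UI i : i \in I0 -> U i = false.
  by move=> iI; rewrite /U pI // aI // subrr; apply/negbTE; rewrite -leNgt.
split=> [||i].
- split=> [i | i iI | i j Dij]; rewrite !bE.
  + by rewrite addr_ge0 // mulr_ge0 // ltW.
  + by rewrite UI // mulr0 addr0 aI.
  have := aD _ _ Dij; have := pD _ _ Dij; have := c0 j.
  case: (boolP (U j)) => [/Ue | _]; case: (boolP (U i)) => [_|];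
    rewrite /U -?leNgt ?mulr1 ?mulr0; lra.
- split=> [i | i iI | i j Dij]; rewrite !xbE !bE.
  + have := pq i; have := q0 i; have := xa0 i; rewrite xbE.
    by case: (boolP (U i)) => [/Ue | _]; rewrite ?mulr1 ?mulr0; lra.
  + by rewrite UI // xI // aI // mulr0 addr0 subrr.
  have := xaD _ _ Dij; have := qD _ _ Dij; have := pq i; have := pq j; have := c0 j.
  rewrite !xbE; case: (boolP (U i)) => [/Ue | _]; case: (boolP (U j)) => [_|];
    rewrite /U -?leNgt ?mulr1 ?mulr0; lra.
- have := c0 i; have := ap i; rewrite bE.
  by case: (boolP (U i)) => [/Ue | _]; rewrite ?mulr1 ?mulr0; lra.
Qed.

(** Put d_i = p_i - a_i.  The two vectors move by d_i and |d_i - c_i|, and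
    d_i + |d_i - c_i| <= 2 G - c_i since both d_i and c_i lie between 0 and G.
    The sum over i is (2 n - 1) G, and (n - 1)^2 >= 0. *)
Lemma split_distance (R : realType) (n : nat) (p q x a : 'rV[R]_n) (c : 'I_n -> R)
  (G := \sum_j c j) :
  (forall i, 0 <= c i) -> (forall i, p 0 i + q 0 i = x 0 i + c i) ->
  (forall i, a 0 i <= p 0 i <= a 0 i + G) ->
  \sum_i `|a 0 i - p 0 i| + \sum_i `|(x - a) 0 i - q 0 i| <= n%:R ^+ 2 * G.
Proof.
move=> c0 pq ap; have G0 : 0 <= G by exact: sumr_ge0.
have n2 : (n%:R *+ 2 - 1 : R) <= n%:R ^+ 2.
  by rewrite -subr_ge0 (_ : _ - _ = (n%:R - 1) ^+ 2) ?sqr_ge0 //; ring.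
apply: le_trans (_ : (n%:R *+ 2 - 1) * G <= _); last by rewrite ler_wpM2r.
rewrite -big_split /=.
apply: le_trans (_ : \sum_(i < n) (G *+ 2 - c i) <= _).
  apply: ler_sum => i _; have /andP[l u] := ap i; have := pq i; have := c0 i.
  have cG : c i <= G by rewrite /G (bigD1 i) //= lerDl sumr_ge0.
  have -> : (x - a) 0 i = x 0 i - a 0 i by rewrite !mxE.
  move=> ci e; rewrite (ler0_norm (_ : a 0 i - p 0 i <= 0)) ?subr_le0 //.
  case: (leP 0 (x 0 i - a 0 i - q 0 i)) => h.
    by rewrite ger0_norm //; lra.
  by rewrite ltr0_norm //; lra.
rewrite big_split /= sumrN -/G sumr_const card_ord.
by rewrite -mulr_natl; lra.
Qed.

(** * Exactness of the penalty *)

Lemma cone_dilworth_dom (R : realType) (n : nat) (X : {set cube n}) (x : 'rV[R]_n) :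
  cone [set v | dilworth_dom X v]%SET x -> cone X x.
Proof.
move=> [lam [lam0 ->]].
have s0 : sublinear_on (cone X) (dot (0 : 'rV[R]_n)) by exact: dot_sublinear.
apply: (sublinear_comb s0 _ _).1 => [v _ | v]; first exact: lam0.
rewrite finset.inE => /existsP[V /andP[/fintype.subsetP VX /sums_toP Vv]].
have -> : vec v = \sum_(u in V) 1 *: vec u :> 'rV[R]_n.
  apply/rowP => i; rewrite summxE mxE -Vv natr_sum; apply: eq_bigr => u _.
  by rewrite !mxE mul1r.
apply: (sublinear_comb s0 _ _).1 => [u _ | u /VX uX]; first exact: ler01.
exact: cone_vec.
Qed.

Lemma cone_monotone (R : realType) (n : nat) (Y : pred (cube n)) (I0 : {set 'I_n})
    (D : rel 'I_n) (hD : preorder_representation Y I0 D)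
    (lam : cube n -> R) (z : cube n -> cube n) :
  (forall v, 0 <= lam v) -> (forall v, lam v != 0 -> Y (z v)) ->
  monotone_vec I0 D (\sum_v lam v *: vec (z v)).
Proof.
have [_ _ _ YE] := hD => lam0 zY.
have E i : (\sum_v lam v *: vec (z v)) 0 i = \sum_v lam v * (z v i)%:R.
  by rewrite summxE; apply: eq_bigr => v _; rewrite !mxE.
split=> [i | i iI | i j Dij]; rewrite !E.
- by apply: sumr_ge0 => v _; rewrite mulr_ge0.
- apply: big1 => v _.
  case: (eqVneq (lam v) 0) => [->|/zY/YE[-> //]]; first by rewrite mul0r.
  by rewrite mulr0.
- apply: ler_sum => v _.
  case: (eqVneq (lam v) 0) => [->|/zY/YE[_ zD]]; first by rewrite !mul0r.
  by rewrite ler_wpM2l // ler_nat zD.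
Qed.

(** By sublinearity a bound on the blocks of a decomposition bounds the
    decomposed vector. *)
Lemma minorant_dilworth (R : realType) (n : nat) (X : {set cube n})
    (f g : cube n -> R) (fg : forall v, f v <= g v)
    (h0 : cube0 \in X -> 0 <= g cube0) (s : 'rV[R]_n -> R) :
  sublinear_minorant X f s ->
  sublinear_minorant [set v | dilworth_dom X v]%SET (dilworth X g) s.
Proof.
move=> [[sZ sD] sf]; split.
  by split=> [r x r0 /cone_dilworth_dom | x y /cone_dilworth_dom Xx /cone_dilworth_dom];
    [exact: sZ | exact: sD].
move=> v; rewrite finset.inE => /(dilworth_witness h0)[V []].
move=> /fintype.subsetP VX /sums_toP Vv _ ->.
have -> : vec v = \sum_(u in V) 1 *: vec u :> 'rV[R]_n.
  apply/rowP => i; rewrite summxE mxE -Vv natr_sum; apply: eq_bigr => u _.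
  by rewrite !mxE mul1r.
have [||_] := @sublinear_comb R n X s _ (mem V) (fun=> 1) vec (conj sZ sD).
- by move=> u _; exact: ler01.
- by move=> u /VX uX; exact: cone_vec.
move/le_trans; apply; apply: ler_sum => u /VX uX; rewrite mul1r.
exact: le_trans (sf u uX) (fg u).
Qed.

(** The greedy form for p lies below h on the members z v, and it changes by at
    most fU - fL per unit of l1 distance between p and their combination. *)
Lemma minorant_perturb (R : realType) (n : nat) (X : {set cube n})
    (hX : intersecting_family X) (f g : cube n -> R)
    (hg : intersecting_submodular X g) (h0 : cube0 \in X -> 0 <= g cube0)
    (fg : forall v, f v <= g v)
    (I0 : {set 'I_n}) (D : rel 'I_n)
    (hD : preorder_representation (dilworth_dom X) I0 D) (fL fU : R)
    (hbnd : forall x, dilworth_dom X x -> fL <= dilworth X g x <= fU)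
    (y : cube n -> R) (z : cube n -> cube n) (p : 'rV[R]_n) :
  (forall v, 0 <= y v) -> (forall v, dilworth_dom X (z v)) ->
  monotone_vec I0 D p ->
  cone X p /\ forall s, sublinear_minorant X f s ->
    s p <= \sum_v y v * dilworth X g (z v)
           + (fU - fL) * \sum_i `|p 0 i - (\sum_v y v *: vec (z v)) 0 i|.
Proof.
move=> y0 zY [p0 pI pD]; have [_ _ DI YE] := hD.
have dsub := dilworth_submodular hX hg h0.
set L := [set v | dilworth_dom X v]%SET.
have LE v : (v \in L) = dilworth_dom X v by rewrite finset.inE.
have [||||||||| a [_ _ aL aM [pL ps]]] :=
  @chain_greedy R n L (dilworth X g) (fU - fL) _ _ _ _ (dilworth0 _ _) _ (vtop I0) p.
- by rewrite LE dilworth_dom0.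
- by move=> u v; rewrite !LE => du dv; case: (dsub _ _ du dv).
- by move=> u v; rewrite !LE => du dv; case: (dsub _ _ du dv).
- by move=> u v; rewrite !LE => du dv; case: (dsub _ _ du dv).
- move=> u v; rewrite !LE => /hbnd/andP[_ ?] /hbnd/andP[? _]; lra.
- rewrite LE; apply/YE; split=> [i iI | i j Dij]; rewrite !ffunE ?iI //.
  by case: (boolP (i \in I0)) => [/(DI _ _ Dij)->|_] //; case: (_ \in _).
- exact: p0.
- by move=> i; rewrite ffunE negbK; exact: pI.
- move=> t t0; rewrite LE; apply/YE; split=> [i iI | i j Dij]; rewrite !ffunE.
    by rewrite pI // ltNge t0.
  by case: (boolP (t < p 0 j)) => // tj; rewrite (lt_le_trans tj (pD _ _ Dij)).
split; first exact: cone_dilworth_dom pL.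
move=> s /(minorant_dilworth fg h0)/ps /le_trans; apply.
set q := (\sum_v _ *: _).
have -> : p = q + (p - q) by rewrite addrC subrK.
rewrite dotDr lerD //.
  rewrite dot_sumr; apply: ler_sum => v _; rewrite dotZr ler_wpM2l // aL ?LE //.
  move=> i; rewrite ffunE; have /YE[+ _] := zY v; move/(_ i).
  by case: (i \in I0) => // ->.
rewrite mulr_sumr; apply: ler_sum => i _.
rewrite (le_trans (ler_norm _)) // normrM.
have -> : (q + (p - q)) 0 i - q 0 i = (p - q) 0 i by rewrite !mxE; ring.
by rewrite ler_wpM2r.
Qed.

(** Points outside the domain of the truncations cannot lower the cost of
    generating x below the value of a sublinear minorant: the penalty paid for
    them covers the price of repairing the combination of their retractions. *)
Lemma penalty_exact (R : realType) (n : nat) (X : {set cube n})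
    (hX : intersecting_family X) (f1 f2 : cube n -> R)
    (hf1 : intersecting_submodular X f1) (hf2 : intersecting_submodular X f2)
    (h01 : cube0 \in X -> 0 <= f1 cube0) (h02 : cube0 \in X -> 0 <= f2 cube0)
    (I0 : {set 'I_n}) (D : rel 'I_n)
    (hD : preorder_representation (dilworth_dom X) I0 D) (fL fU : R)
    (hbnd1 : forall x, dilworth_dom X x -> fL <= dilworth X f1 x <= fU)
    (hbnd2 : forall x, dilworth_dom X x -> fL <= dilworth X f2 x <= fU)
    (s : 'rV[R]_n -> R)
    (hs : sublinear_minorant X (fun v => Num.min (f1 v) (f2 v)) s)
    (y1 y2 : cube n -> R) (x : 'rV[R]_n) :
  (forall v, 0 <= y1 v) -> (forall v, 0 <= y2 v) -> cone X x ->
  \sum_v y1 v *: vec v + \sum_v y2 v *: vec v = x ->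
  s x <= \sum_v y1 v * extension X I0 D fL fU f1 v
         + \sum_v y2 v * extension X I0 D fL fU f2 v.
Proof.
move=> y10 y20 Xx yx; set r := retraction I0 D.
have rY v : dilworth_dom X (r v) by exact: retraction_mem hD v.
pose p := \sum_v y1 v *: vec (r v) : 'rV[R]_n.
pose q := \sum_v y2 v *: vec (r v) : 'rV[R]_n.
have pK : monotone_vec I0 D p by apply: cone_monotone hD _ _ _ _.
have qK : monotone_vec I0 D q by apply: cone_monotone hD _ _ _ _.
have xK : monotone_vec I0 D x.
  have [lam [lam0 ->]] := Xx; rewrite big_mkcond /=.
  rewrite (eq_bigr (fun v => (if v \in X then lam v else 0) *: vec v)); last first.
    by move=> v _; case: ifP; rewrite ?scale0r.
  apply: (cone_monotone hD) => v; first by case: ifP.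
  by case: ifP => [/dilworth_dom_mem|]; rewrite ?eqxx.
(* On I0 all of p, q and x vanish; elsewhere the retraction only adds
   elements, so p + q can only exceed x. *)
pose c i := (p + q - x) 0 i.
have cE i : c i = \sum_v (y1 v + y2 v) * ((r v i)%:R - (v i)%:R).
  rewrite /c -yx /p /q !mxE !summxE -!big_split -sumrN -big_split /=.
  by apply: eq_bigr => v _; rewrite !mxE; ring.
have cI i : i \in I0 -> c i = 0.
  move=> iI; case: pK qK xK => [_ pI _] [_ qI _] [_ xI _].
  by rewrite /c !mxE pI // qI // xI // addr0 subr0.
have c0 i : 0 <= c i.
  case: (boolP (i \in I0)) => [/cI-> //|iI]; rewrite cE.
  apply: sumr_ge0 => v _; apply: mulr_ge0; first exact: addr_ge0.
  rewrite subr_ge0 ler_nat.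
  by have := retraction_ge hD iI (x := v); case: (v i) => // ->.
have pqc i : p 0 i + q 0 i = x 0 i + c i by rewrite /c !mxE; ring.
have [a [aK xaK ap]] := monotone_split pK qK xK c0 pqc.
have near := split_distance c0 pqc ap.
have fg1 v : Num.min (f1 v) (f2 v) <= f1 v by rewrite ge_min lexx.
have fg2 v : Num.min (f1 v) (f2 v) <= f2 v by rewrite ge_min lexx orbT.
have [Xa /(_ s hs)] := minorant_perturb hX hf1 h01 fg1 hD hbnd1 y10 rY aK.
have [Xxa /(_ s hs)] := minorant_perturb hX hf2 h02 fg2 hD hbnd2 y20 rY xaK.
rewrite -/p -/q; move: near; set d1 := \sum_i `|a 0 i - _|; set d2 := \sum_i _.
set G := \sum_j c j => near s2 s1.
have LU : 0 <= fU - fL.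
  by have /andP[] := hbnd1 _ (dilworth_dom0 X); lra.
have sx : s x <= s a + s (x - a).
  have -> : s x = s (a + (x - a)) by rewrite addrC subrK.
  by case: hs => -[_ sD] _; exact: sD.
have GE : G <= \sum_v (y1 v + y2 v) * dist1 v (r v).
  rewrite /G (eq_bigr _ (fun i _ => cE i)) exchange_big /=; apply: ler_sum => v _.
  rewrite -mulr_sumr ler_wpM2l ?addr_ge0 //; apply: ler_sum => i _.
  by rewrite distrC ler_norm.
pose C : R := n%:R ^+ 2 * (fU - fL).
have extE y g : \sum_v y v * extension X I0 D fL fU g v =
    \sum_v y v * dilworth X g (r v) + C * \sum_v y v * dist1 v (r v).
  rewrite mulr_sumr -big_split; apply: eq_bigr => v _.
  by rewrite /extension -/r -/C /=; ring.
have CG : (fU - fL) * (d1 + d2) <= C * \sum_v (y1 v + y2 v) * dist1 v (r v).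
  have C0 : 0 <= n%:R ^+ 2 :> R by rewrite exprn_ge0.
  apply: le_trans (ler_wpM2l LU near) _.
  by rewrite mulrA [_ * n%:R ^+ 2]mulrC -/C ler_wpM2l // mulr_ge0.
rewrite !extE (le_trans sx) //.
move: CG; rewrite (eq_bigr (fun v => y1 v * dist1 v (r v) + y2 v * dist1 v (r v))); last first.
  by move=> v _; rewrite mulrDl.
by rewrite big_split /= mulrDr mulrDr; lra.
Qed.

Lemma extension_mem (R : realType) (n : nat) (X : {set cube n})
    (I0 : {set 'I_n}) (D : rel 'I_n)
    (hD : preorder_representation (dilworth_dom X) I0 D) (fL fU : R)
    (g : cube n -> R) v :
  dilworth_dom X v -> extension X I0 D fL fU g v = dilworth X g v.
Proof.
move=> dv; rewrite /extension (retraction_id hD dv) (_ : dist1 v v = 0).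
  by rewrite mulr0 addr0.
by apply: big1 => i _; rewrite subrr normr0.
Qed.

Theorem proposition3 (R : realType) (n : nat) (X : {set cube n})
    (hX : intersecting_family X)
    (f1 f2 : cube n -> R)
    (hf1 : intersecting_submodular X f1)
    (hf2 : intersecting_submodular X f2)
    (h0 : cube0 \notin X \/ (0 <= f1 cube0 /\ 0 <= f2 cube0))
    (I0 : {set 'I_n}) (D : rel 'I_n)
    (hD : preorder_representation (dilworth_dom X) I0 D)
    (fL fU : R)
    (hbnd1 : forall x, dilworth_dom X x -> fL <= dilworth X f1 x <= fU)
    (hbnd2 : forall x, dilworth_dom X x -> fL <= dilworth X f2 x <= fU)
    (xq : 'rV[rat]_n) (muq : rat)
    (hx : cone X (map_mx (ratr : rat -> R) xq)) :
  let f := fun v : cube n => Num.min (f1 v) (f2 v) in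
  let g1 := extension X I0 D fL fU f1 in
  let g2 := extension X I0 D fL fU f2 in
  let xbar : 'rV[R]_n := map_mx ratr xq in
  let mubar : R := ratr muq in
  let feasible := (EP g1 `&` EP g2)%classic in
  [/\ is_sconv X f (sconv X f),
      submodular g1,
      submodular g2,
      exists a, is_maximizer xbar feasible a &
      forall a, is_maximizer xbar feasible a ->
        [/\ dot xbar a = sconv X f xbar,
            forall x, cone X x -> dot a x <= sconv X f x &
            separation_answer (cone X) (sconv X f) xbar mubar
              (if mubar < dot xbar a then Some (a, 0) else None)]].
Proof.
move=> f g1 g2 xbar mubar feasible.
have h01 : cube0 \in X -> 0 <= f1 cube0 by case: h0 => [/negbTE->|[]].
have h02 : cube0 \in X -> 0 <= f2 cube0 by case: h0 => [/negbTE->|[]].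
have fs : is_sconv X f (sconv X f).
  by apply: sconvP => X0; rewrite le_min h01 // h02.
have [smin smax] := fs; set s := sconv X f in smin smax *.
have feas_le a : feasible a -> forall x, cone X x -> dot a x <= s x.
  move=> [a1 a2]; apply: smax; split; first exact: dot_sublinear.
  move=> v vX; have dv := dilworth_dom_mem vX.
  rewrite le_min (le_trans (a1 v)) ?(le_trans (a2 v)) //.
    by rewrite /g2 (extension_mem hD) // dilworth_le.
  by rewrite /g1 (extension_mem hD) // dilworth_le.
have [a [fa sa]] : exists a, feasible a /\ s xbar <= dot xbar a.
  (* The system states feasibility for g1 and g2 and s xbar <= <a, xbar>, in
     this order inr (inl v), inr (inr v) and inl tt. *)
  pose A (j : unit + (cube n + cube n)) : 'rV[R]_n :=
    match j with inl _ => - xbar | inr (inl v) | inr (inr v) => vec v end.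
  pose b (j : unit + (cube n + cube n)) : R :=
    match j with inl _ => - s xbar | inr (inl v) => g1 v | inr (inr v) => g2 v end.
  case: (farkas A b) => [[a ha] | [y [y0 yA yb]]].
    exists a; split.
      by split=> v; [exact: (ha (inr (inl v))) | exact: (ha (inr (inr v)))].
    by have := ha (inl tt); rewrite /= -scaleN1r dotZr mulN1r lerN2 [dot xbar a]dotC.
  have split_sum (M : nmodType) (F : unit + (cube n + cube n) -> M) :
    \sum_j F j = F (inl tt) + (\sum_v F (inr (inl v)) + \sum_v F (inr (inr v))).
    by rewrite !big_sumType /=; congr (_ + _); apply: big_pred1 => -[].
  exfalso; move: yA yb; rewrite !split_sum /= => yA yb.
  have {}yA : \sum_v y (inr (inl v)) *: vec v + \sum_v y (inr (inr v)) *: vec v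
     = y (inl tt) *: xbar.
    by apply/eqP; rewrite -subr_eq0 -[X in _ == X]yA scalerN addrC.
  have Xy : cone X (y (inl tt) *: xbar) by exact: coneZ.
  have := penalty_exact hX hf1 hf2 h01 h02 hD hbnd1 hbnd2 smin
    (fun v => y0 (inr (inl v))) (fun v => y0 (inr (inr v))) Xy yA.
  rewrite smin.1.1 // -/g1 -/g2.
  by move: yb; rewrite mulrN; lra.
have feas_dot c : feasible c -> dot xbar c <= s xbar.
  by move=> fc; rewrite dotC; exact: feas_le.
split=> //.
- apply: (extension_submodular hD) => // u v du dv.
  by case: (dilworth_submodular hX hf1 h01 du dv).
- apply: (extension_submodular hD) => // u v du dv.
  by case: (dilworth_submodular hX hf2 h02 du dv).
- by exists a; split=> // c fc; apply: le_trans sa; exact: feas_dot.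
move=> c [fc cmax].
have cE : dot xbar c = s xbar.
  by apply/le_anti; rewrite feas_dot //= (le_trans sa) // cmax.
split=> //; first exact: feas_le.
case: ifP => [muc | /negbT]; rewrite /separation_answer.
  split; first by move=> x Xx; rewrite addr0; exact: feas_le.
  by rewrite addr0 dotC.
by rewrite -leNgt cE.
Qed.
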